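(* Let $M$ be a compact finite-dimensional manifold and $f\colon M\to M$ a continuous map. The set $\mathcal{O}$ of all observable measures for $f$ is finite if and only if there exist finitely many SRB measures for $f$ such that the union of their basins of attraction covers $M$ up to a set of zero Lebesgue measure. In this case $\mathcal{O}$ is the set of all SRB measures for $f$.
   Context: Let $m$ be a Lebesgue measure on $M$, normalized so that $m(M)=1$; $m$ is not assumed to be $f$-invariant. Let $\mathcal{P}$ be the set of all Borel probability measures on $M$, endowed with the weak$^*$ topology, and fix a metric $\mathrm{dist}$ on $\mathcal{P}$ inducing this topology. For $x\in M$, let $p\omega(x)\subset\mathcal{P}$ be the set of all weak$^*$ limits of convergent subsequences of the sequence $\left\{\frac1n\sum_{j=0}^{n-1}\delta_{f^j(x)}\right\}_{n\ge 1}$, where $\delta_y$ is the Dirac probability measure supported at $y$. For $\mu\in\mathcal{P}$, $\mathrm{dist}(p\omega(x),\mu)$ denotes the distance from the point $\mu$ to the set $p\omega(x)$. A measure $\mu\in\mathcal{P}$ is called SRB (or physical) for $f$ if the set $A(\mu)=\{x\in M:\ p\omega(x)=\{\mu\}\}$ has positive Lebesgue measure $m$; the set $A(\mu)$ is called the basin of attraction of $\mu$. A measure $\mu\in\mathcal{P}$ is called observable (or SRB-like) for $f$ if for every $\varepsilon>0$ the set $A_\varepsilon(\mu)=\{x\in M:\ \mathrm{dist}(p\omega(x),\mu)<\varepsilon\}$ has positive Lebesgue measure $m$. The set of all observable measures for $f$ is denoted $\mathcal{O}$. *)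

(* Defs.v *)
From HB Require Import structures.
From mathcomp Require Import all_boot all_order all_algebra.
From mathcomp Require Import all_classical all_reals all_analysis.

Set Implicit Arguments.
Unset Strict Implicit.
Unset Printing Implicit Defensive.

Import Order.TTheory GRing.Theory Num.Theory.
Import numFieldNormedType.Exports.

Local Open Scope classical_set_scope.
Local Open Scope ring_scope.

Section product_cons.
Context d (T : measurableType d) (R : realType) (n : nat).
Variables (nu : {sigma_finite_measure set T -> \bar R})
          (mu : {sigma_finite_measure set (n.-tuple T) -> \bar R}).

Definition cons_pair (p : T * n.-tuple T) : n.+1.-tuple T :=
  [the n.+1.-tuple T of p.1 :: p.2].

Let measurable_cons_pair : measurable_fun [set: T * n.-tuple T] cons_pair.
Proof. exact: measurable_cons. Qed.

Definition product_cons : set (n.+1.-tuple T) -> \bar R :=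
  fun A => (nu \x mu)%E (cons_pair @^-1` A).

Let product_cons0 : product_cons set0 = 0%E.
Proof. by rewrite /product_cons preimage_set0 measure0. Qed.

Let product_cons_ge0 A : (0 <= product_cons A)%E.
Proof. exact: measure_ge0. Qed.

Let product_cons_sigma_additive : semi_sigma_additive product_cons.
Proof.
move=> F mF tF mUF; rewrite /product_cons preimage_bigcup.
apply: measure_semi_sigma_additive.
- by move=> k; rewrite -[X in measurable X]setTI; exact: measurable_cons_pair.
- apply/trivIsetP => /= i j _ _ ij; rewrite -preimage_setI.
  by move/trivIsetP : tF => /(_ _ _ _ _ ij) ->//; rewrite preimage_set0.
- rewrite -preimage_bigcup -[X in measurable X]setTI.
  exact: measurable_cons_pair.
Qed.

HB.instance Definition _ := isMeasure.Build _ _ _ product_cons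
  product_cons0 product_cons_ge0 product_cons_sigma_additive.

Let product_cons_sigma_finite : sigma_finite setT product_cons.
Proof.
have /sigma_finiteP[F [TF ndF Foo]] := sigma_finiteT nu.
have /sigma_finiteP[G [TG ndG Goo]] := sigma_finiteT mu.
pose u (t : n.+1.-tuple T) : T * n.-tuple T :=
  (tnth t ord0, [tuple of behead t]).
have um : measurable_fun [set: n.+1.-tuple T] u.
  by apply/measurable_fun_pair => /=;
    [exact: measurable_tnth | exact: measurable_behead].
exists (fun k => u @^-1` (F k `*` G k)).
  apply/esym; rewrite -subTset => t _.
  have [k _ Fk] : (\bigcup_i F i) (tnth t ord0) by rewrite -TF.
  have [l _ Gl] : (\bigcup_i G i) [tuple of behead t] by rewrite -TG.
  exists (maxn k l) => //; split.
  - by move: Fk; exact/subsetPset/ndF/leq_maxl.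
  - by move: Gl; exact/subsetPset/ndG/leq_maxr.
move=> k; have [mFk Fkoo] := Foo k; have [mGk Gkoo] := Goo k; split.
  by rewrite -[X in measurable X]setTI; apply: um => //; exact: measurableX.
rewrite /product_cons (_ : _ @^-1` _ = F k `*` G k).
  by rewrite product_measure1E// lte_mul_pinfty// ge0_fin_numE.
rewrite -comp_preimage (_ : u \o cons_pair = id)//.
by apply/funext => -[x t]; congr pair; exact/val_inj.
Qed.

HB.instance Definition _ := @Measure_isSigmaFinite.Build _ _ _ product_cons
  product_cons_sigma_finite.

End product_cons.

Section lebesgue_measure_Rn.
Variable R : realType.
Local Notation mR := (measurableTypeR R).

(* Lebesgue measure on R^n, with R^n represented by n-tuples carrying the
   product sigma-algebra: the n-fold product of lebesgue_measure. *)
Fixpoint lebesgue_tuple (n : nat) :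
    {sigma_finite_measure set (n.-tuple mR) -> \bar R} :=
  match n with
  | 0 => dirac [tuple of [::]]
  | k.+1 => product_cons (@lebesgue_measure R) (lebesgue_tuple k)
  end.

Definition row_of_tuple n (t : n.-tuple mR) : 'rV[R]_n := \row_i tnth t i.

End lebesgue_measure_Rn.

Section borel_probabilities.
Variables (R : realType) (M : ptopologicalType).

Definition borel : Type := g_sigma_algebraType (@open M).
HB.instance Definition _ := Measurable.on borel.

(* A library measure is a function on all sets, unconstrained off the
   sigma-algebra, so distinct terms of [probability borel R] may agree on every
   Borel set. Requiring the value 0 on non-Borel sets leaves exactly one term for
   each Borel probability measure; see [borel_prob_eq]. *)
Record borel_prob := BorelProb {
  bprob :> probability borel R ;
  bprob_nonmeasurable : forall A, ~ measurable A -> bprob A = 0%E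
}.

Lemma borel_prob_eq (mu nu : borel_prob) :
  (forall A, measurable A -> mu A = nu A) -> mu = nu.
Proof.
case: mu nu => [mu mu0] [nu nu0] /= munu.
have E : mu = nu :> (set borel -> \bar R).
  apply/funext => A; have [mA|mA] := pselect (measurable A); first exact: munu.
  by rewrite mu0// nu0.
have {}E : mu = nu.
  move: mu nu {mu0 nu0 munu} E => [mu cmu] [nu cnu] /= E; rewrite E in cmu *.
  congr Probability.Pack.
  case: cmu => [[a1 a2] [a3] [a4] [a5] [a6] [a7] [a8]].
  case: cnu => [[b1 b2] [b3] [b4] [b5] [b6] [b7] [b8]].
  rewrite (Prop_irrelevance b1 a1) (Prop_irrelevance b2 a2).
  rewrite (Prop_irrelevance b3 a3) (Prop_irrelevance b4 a4).
  rewrite (Prop_irrelevance b5 a5) (Prop_irrelevance b6 a6).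
  by rewrite (Prop_irrelevance b7 a7) (Prop_irrelevance b8 a8).
by rewrite E in mu0 *; rewrite (Prop_irrelevance nu0 mu0).
Qed.

Section truncation.
Variable mu : probability borel R.

Definition mtrunc (A : set borel) : \bar R :=
  if pselect (measurable A) then mu A else 0%E.

Let mtruncE A : measurable A -> mtrunc A = mu A.
Proof. by rewrite /mtrunc; case: pselect. Qed.

Let mtrunc0 : mtrunc set0 = 0%E.
Proof. by rewrite mtruncE// measure0. Qed.

Let mtrunc_ge0 A : (0 <= mtrunc A)%E.
Proof. by rewrite /mtrunc; case: pselect => // ?; exact: measure_ge0. Qed.

Let mtrunc_sigma_additive : semi_sigma_additive mtrunc.
Proof.
move=> F mF tF mUF; rewrite mtruncE//.
rewrite (_ : (fun n => _) = fun n => (\sum_(0 <= i < n) mu (F i))%E); last first.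
  by apply/funext => n; apply: eq_bigr => i _; exact: mtruncE.
exact: measure_semi_sigma_additive.
Qed.

HB.instance Definition _ := isMeasure.Build _ _ _ mtrunc
  mtrunc0 mtrunc_ge0 mtrunc_sigma_additive.

Let mtrunc_setT : mtrunc setT = 1%E.
Proof. by rewrite mtruncE// probability_setT. Qed.

HB.instance Definition _ :=
  Measure_isProbability.Build _ _ _ mtrunc mtrunc_setT.

Let mtrunc_nonmeasurable A : ~ measurable A -> mtrunc A = 0%E.
Proof. by rewrite /mtrunc; case: pselect. Qed.

Definition borel_prob_of : borel_prob :=
  @BorelProb mtrunc mtrunc_nonmeasurable.

End truncation.

HB.instance Definition _ := gen_eqMixin borel_prob.
HB.instance Definition _ := gen_choiceMixin borel_prob.

Definition weak_eval (mu : borel_prob) : {ptws continuousType M R -> R} :=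
  fun phi => \int[mu]_x phi x.

(* The weak* topology: the initial topology of the maps mu |-> \int phi dmu,
   phi ranging over the continuous functions on M. *)
HB.instance Definition _ :=
  Topological.copy borel_prob (initial_topology weak_eval).

End borel_probabilities.

Section metrization.
Variables (R : realType) (T : topologicalType) (dist : T -> T -> R).

Definition metrizes : Prop :=
  [/\ forall x y, dist x y = 0 <-> x = y,
      forall x y, dist x y = dist y x,
      forall x y z, dist x z <= dist x y + dist y z &
      forall x, nbhs x =
        filter_from [set e | 0 < e] (fun e => [set y | dist x y < e])].

(* Distance to a set; it is +oo for the empty set. *)
Definition dist_set (A : set T) (y : T) : \bar R :=
  ereal_inf [set (dist x y)%:E | x in A].

End metrization.

Section empirical_measures.
Variables (R : realType) (M : ptopologicalType) (f : M -> M) (x : M) (n : nat).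

(* n.+1 terms are averaged: the sequence starts with the Dirac mass at x. *)
Definition empirical_measure : set (borel M) -> \bar R :=
  mscale (n.+1%:R^-1)%:nng (msum (fun j => dirac (iter j f x : borel M)) n.+1).

HB.instance Definition _ := Measure.on empirical_measure.

Let empirical_setT : empirical_measure setT = 1%E.
Proof.
rewrite /empirical_measure /mscale /= /msum.
rewrite (eq_bigr (fun=> 1%E)) => [|j _]; last exact: diracT.
by rewrite sumEFin -EFinM big_const_ord iter_addr_0 mulVf// pnatr_eq0.
Qed.

HB.instance Definition _ :=
  Measure_isProbability.Build _ _ _ empirical_measure empirical_setT.

Definition empirical : borel_prob R M := borel_prob_of empirical_measure.

End empirical_measures.

Section srb_like.
Variables (R : realType) (M : ptopologicalType) (f : M -> M).

Definition pomega (x : M) : set (borel_prob R M) :=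
  [set mu | exists2 s : nat -> nat, {homo s : i j / (i < j)%N} &
     (fun k => empirical R f x (s k)) @ \oo --> mu].

Definition basin (mu : borel_prob R M) : set M :=
  [set x | pomega x = [set mu]].

Definition eps_basin (dist : borel_prob R M -> borel_prob R M -> R)
    (eps : R) (mu : borel_prob R M) : set M :=
  [set x | (dist_set dist (pomega x) mu < eps%:E)%E].

Definition SRB (m : probability (borel M) R) : set (borel_prob R M) :=
  [set mu | (0 < m (basin mu))%E].

Definition observable (m : probability (borel M) R)
    (dist : borel_prob R M -> borel_prob R M -> R) : set (borel_prob R M) :=
  [set mu | forall eps : R, 0 < eps -> (0 < m (eps_basin dist eps mu))%E].

End srb_like.

Section manifolds.
Variables (R : realType) (n : nat).

(* In finite dimension 'd g x is continuous in x as soon as each 'd g x v is. *)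
Definition C1_on (U : set 'rV[R]_n) (g : 'rV[R]_n -> 'rV[R]_n) : Prop :=
  (forall x, U x -> differentiable g x) /\
  forall v, {within U, continuous (fun x => 'd g x v)}.

Variable M : ptopologicalType.

(* A homeomorphism from an open subset of M onto an open subset of R^n. Both
   maps are totalized; their values outside the two open sets are irrelevant. *)
Record chart := Chart {
  chart_dom : set M ;
  chart_map : M -> 'rV[R]_n ;
  chart_inv : 'rV[R]_n -> M ;
  chart_dom_open : open chart_dom ;
  chart_img_open : open (chart_map @` chart_dom) ;
  chart_mapK : forall x, chart_dom x -> chart_inv (chart_map x) = x ;
  chart_map_continuous : {within chart_dom, continuous chart_map} ;
  chart_inv_continuous :
    {within chart_map @` chart_dom, continuous chart_inv}
}.

Record C1_atlas := C1Atlas {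
  charts : set chart ;
  charts_cover : \bigcup_(c in charts) chart_dom c = setT ;
  charts_compatible : forall c1 c2, charts c1 -> charts c2 ->
    C1_on (chart_map c1 @` (chart_dom c1 `&` chart_dom c2))
          (chart_map c2 \o chart_inv c1)
}.

(* In every chart the measure has a continuous positive density with respect to
   Lebesgue measure on R^n, as for the volume of a Riemannian metric. *)
Definition is_lebesgue (A : C1_atlas) (m : probability (borel M) R) : Prop :=
  forall c, charts A c -> exists rho : 'rV[R]_n -> R,
    [/\ forall y, (chart_map c @` chart_dom c) y -> 0 < rho y,
        {within chart_map c @` chart_dom c, continuous rho} &
        forall W : set (borel M), measurable W -> W `<=` chart_dom c ->
          m W = (\int[lebesgue_tuple R n]_(t in
                    @row_of_tuple R n @^-1` (chart_map c @` W))
                    (rho (row_of_tuple t))%:E)%E].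

End manifolds.

(* Main.v *)
From HB Require Import structures.
Require Import Defs.
From mathcomp Require Import all_boot all_order all_algebra.
From mathcomp Require Import all_classical all_reals all_analysis.
From mathcomp Require Import measurable_realfun zify ring lra.

Set Implicit Arguments.
Unset Strict Implicit.
Unset Printing Implicit Defensive.

Import Order.TTheory GRing.Theory Num.Theory.
Import numFieldNormedType.Exports.

Local Open Scope classical_set_scope.
Local Open Scope ring_scope.

(** The measure [m] only enters through null sets, so the theorem is about the
    sequence e_n(x) of empirical measures of a single orbit.

    Suppose first that finitely many basins cover almost everything. If [mu]
    differs from the corresponding measures, a small ball around [mu] avoids all
    of them, so the points whose limit set meets that ball lie in the null
    complement of the basins and [mu] is not observable. Conversely every SRB
    measure is observable, its basin being contained in each of the sets that
    define observability.

    Suppose now that the set O of observable measures is finite. Measures outside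
    O have a ball that is missed by the limit sets of almost all points. The
    measures e_n(d), with d in a countable dense set of points, are dense among
    the limits, so countably many such balls suffice and the limit set of almost
    every x lies in O ([pomega_observable]). That limit set is nonempty because
    the e_n(x) are relatively compact, and it is a singleton because
    e_{n+1}(x) - e_n(x) tends to 0: an orbit of measures with two isolated limit
    points would leave a small ball around the first one infinitely often, and
    the exit times would produce a limit both near to and away from that point
    ([finite_pomega_set1]). So almost every x lies in the basin of some element
    of O, and the basins of the non-SRB ones are null.

    Relative compactness ([list_average_subcvg]) is obtained without representing
    positive functionals by measures. Points of M are coded by their membership
    in the first k sets of a countable basis, read as a binary number. The orbit
    segment, sorted by code, becomes a step function from [0, 1[ to M, which
    pushes Lebesgue measure forward to the empirical measure. Sorting makes the
    code of the step function at t smaller than v exactly when t lies below the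
    proportion of points with code smaller than v. Along a diagonal subsequence
    all these proportions converge, and then for all but countably many t every
    code is eventually constant, which forces convergence in M. The law of the
    pointwise limit is the required measure, by dominated convergence.

    Since [m] is arbitrary on non-Borel sets, one also needs that the basins are
    Borel. Relative compactness turns their definition into countable
    combinations of conditions on the continuous maps x |-> e_n(x)
    ([eps_basinP] and [basinP]). *)

(** * Subsequences and countable bases *)

(** Conditions that each hold infinitely often are met one after the other along
    a subsequence. This is the source of all subsequences below. *)
Lemma frequently_subseq (P : nat -> nat -> Prop) :
  (forall k N, exists2 n, (N <= n)%N & P k n) ->
  exists2 u : nat -> nat, {homo u : i j / (i < j)%N} & forall k, P k (u k).
Proof.
move=> freqP.
pose Q (p q : nat * nat) := [/\ q.1 = p.1.+1, (p.2 < q.2)%N & P q.1 q.2].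
have [n0 _ Pn0] := freqP 0%N 0%N.
have [p|g [g0 gQ]] := @dependent_choice _ Q _ (0%N, n0).
  by apply: cid; have [n pn Pn] := freqP p.1.+1 p.2.+1; exists (p.1.+1, n).
have gE k : (g k).1 = k.
  by elim: k => [|k IH]; [rewrite g0|case: (gQ k) => ->; rewrite IH].
exists (fun k => (g k).2) => [|k].
  by apply: homo_ltn; [exact: ltn_trans|move=> k; case: (gQ k)].
by case: k => [|k]; [rewrite g0|case: (gQ k) => _ _; rewrite gE].
Qed.

Lemma homo_ltn_ge (u : nat -> nat) :
  {homo u : i j / (i < j)%N} -> forall k, (k <= u k)%N.
Proof. by move=> uh; elim=> // k IH; apply: leq_ltn_trans IH (uh _ _ _). Qed.

Lemma cvg_homo_ltn (u : nat -> nat) :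
  {homo u : i j / (i < j)%N} -> u @ \oo --> \oo.
Proof.
move=> uh A [N _ NA]; exists N => // k /= Nk; apply: NA => /=.
exact: leq_trans Nk (homo_ltn_ge uh k).
Qed.

(** The rows have a cluster point in the product of countably many segments,
    compact by Tychonoff's theorem. Each neighborhood of it constraining finitely
    many coordinates is visited infinitely often. *)
Lemma diagonal_subseq (R : realType) (a : nat -> nat -> R) :
  (forall k i, 0 <= a k i <= 1) ->
  exists2 u : nat -> nat, {homo u : i j / (i < j)%N} &
  exists L : nat -> R, forall i, (fun k => a (u k) i) @ \oo --> L i.
Proof.
move=> a01.
have /= := @tychonoff nat (fun=> R) (fun=> `[0 : R, 1]%classic)
  (fun=> @segment_compact _ _ _).
move=> /(_ (a @ \oo) _)[].
  by exists 0%N => // k _ /= i; rewrite in_itv /= a01.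
move=> L [_ clL].
have [k N|u uh uL] := frequently_subseq
    (P := fun k n => forall i, (i <= k)%N -> `|L i - a n i| < k.+1%:R^-1).
  have nL : forall j, nbhs (L : prod_topology (fun=> R))
      [set g | forall i, (i <= j)%N -> `|L i - g i| < k.+1%:R^-1].
    have pr i : nbhs (L : prod_topology (fun=> R))
        [set g | `|L i - g i| < k.+1%:R^-1].
      have k0 : 0 < k.+1%:R^-1 :> R by rewrite invr_gt0.
      exact: (@proj_continuous nat (fun=> R) i L _ (nbhsx_ballx (L i) _ k0)).
    have FS := @filterS _ _ (nbhs_filter (L : prod_topology (fun=> R))).
    have FI := @filterI _ _ (nbhs_filter (L : prod_topology (fun=> R))).
    elim=> [|j IH].
      by move: (pr 0%N); apply: FS => g /= g0 i; rewrite leqn0 => /eqP ->.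
    move: (FI _ _ IH (pr j.+1)); apply: FS => g [/= gj gj1] i.
    by rewrite leq_eqVlt => /predU1P[->//|]; exact: gj.
  have [|g [[n Nn <-] gk]] := clL (a @` [set n | (N <= n)%N]) _ _ (nL k).
    by exists N => // n Nn; exists n.
  by exists n.
exists u => //; exists L => i; apply/cvgrPdist_lt => e e0.
near=> k.
have ik : (i <= k)%N by near: k; exists i.
apply: lt_trans (uL k i ik) _.
by near: k; exact: near_infty_natSinv_lt (PosNum e0).
Unshelve. all: by end_near. Qed.

Definition basis_seq (M : ptopologicalType) (U : nat -> set M) : Prop :=
  (forall i, open (U i)) /\
  forall x A, nbhs x A -> exists2 i, U i x & U i `<=` A.

Lemma second_countable_seq (M : ptopologicalType) : @second_countable M ->
  exists U : nat -> set M, basis_seq U.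
Proof.
move=> [B /countable_injP[g ginj] [Bo Bx]].
(* g is injective on B, so the union has at most one term; it is empty, hence
   open, at the indices that g misses *)
exists (fun n => \bigcup_(V in [set V | B V /\ g V = n]) V); split=> [i|x A].
  by apply: bigcup_open => V [/Bo].
move=> /Bx[V [BV Vx] VA]; exists (g V); first by exists V.
by move=> y [W [BW gW] Wy]; apply: VA; rewrite -(ginj W V) ?inE.
Qed.

(** In a compact Hausdorff space the closures of the basis sets also shrink to
    points. *)
Lemma compact_regular_basis (M : ptopologicalType) (U : nat -> set M) :
  hausdorff_space M -> compact [set: M] -> basis_seq U ->
  forall (x : M) A, nbhs x A -> exists2 i, U i x & closure (U i) `<=` A.
Proof.
move=> hM cM [_ Ub] x A xA.
have [B xB BA] := compact_regular hM cM (filterT : nbhs x setT) xA.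
by have [i Uix UiB] := Ub x B xB; exists i => // y /(closureS UiB); exact: BA.
Qed.

(** * Sorting finite lists of points by their position in a basis *)

Section code.
Variables (M : ptopologicalType) (U : nat -> set M).

(** The membership of x in U 0, ..., U (k - 1), most significant bit first: the
    natural order on codes is the lexicographic order, and a longer code
    determines the shorter ones monotonically. *)
Fixpoint code k (x : M) : nat :=
  if k is k'.+1 then (code k' x).*2 + (x \in U k') else 0.

Lemma code_le j k x y : (j <= k)%N ->
  (code k x <= code k y)%N -> (code j x <= code j y)%N.
Proof.
move=> /subnK <-; elim: (k - j)%N => // i IH; rewrite addSn /= => xy.
apply: IH.
by have := half_leq xy; rewrite -!(addnC (nat_of_bool _)) !half_bit_double.
Qed.

Lemma code_lt k x : (code k x < 2 ^ k)%N.
Proof. by elim: k => //= k IH; rewrite expnS; case: (_ \in _); lia. Qed.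

(** Compactness provides a cluster point p. A basis set around p contains z n
    infinitely often, hence eventually, as membership in it is recorded by the
    last bit of a code. *)
Lemma code_cvg (z : nat -> M) : compact [set: M] -> basis_seq U ->
  (forall k, exists c, \forall n \near \oo, code k (z n) = c) ->
  exists p : M, z @ \oo --> p.
Proof.
move=> cM [Uo Ub] zc.
have [|p [_ clp]] := cM (z @ \oo) _ _; first exact: filterT.
exists p => A /Ub[i Uip UiA]; have [c [N _ Nc]] := zc i.+1.
have nU : nbhs p (U i) by apply: open_nbhs_nbhs; split.
have [|_ [[n /= Nn <-] Uzn]] := clp (z @` [set n | (N <= n)%N]) (U i) _ nU.
  by exists N => // n Nn; exists n.
exists N => // m Nm; apply: UiA.
move: (Nc m Nm); rewrite /= -(Nc n Nn) /= => /(congr1 odd).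
by rewrite !oddD !odd_double !oddb (mem_set Uzn) => /set_mem.
Qed.

End code.

Section quantile.
Variables (R : realType) (M : ptopologicalType) (U : nat -> set M).
Local Notation code := (code U).

(** The quantile function on [0, 1[ of the uniform distribution on l, for the
    order given by [code k]. The default value [point] only serves outside
    [0, 1[ or for an empty list. *)
Definition quantile k (l : seq M) (t : R) : M :=
  nth point (sort (relpre (code k) leq) l) (Num.truncn ((size l)%:R * t)).

(** The distribution function of the codes, with a strict inequality so that it
    matches intervals closed on the left. *)
Definition code_cdf j v (l : seq M) : R :=
  (count (fun x => code j x < v)%N l)%:R / (size l)%:R.

Lemma code_cdf01 j v l : 0 <= code_cdf j v l <= 1.
Proof.
rewrite /code_cdf divr_ge0 ?ler0n//=; have [->|l0] := posnP (size l).
  by rewrite invr0 mulr0.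
by rewrite ler_pdivrMr ?ltr0n// mul1r ler_nat count_size.
Qed.

(** The Galois connection between a distribution function and its quantile
    function. Sorting by [code k] sorts by all shorter codes at once, so one
    step function serves every j up to k. *)
Lemma code_quantile_lt k j v l t : (j <= k)%N -> 0 <= t < 1 -> l != [::] ->
  (code j (quantile k l t) < v)%N = (t < code_cdf j v l).
Proof.
move=> jk /andP[t0 t1] l0; have sl0 : (0 < size l)%N by case: l l0.
rewrite /code_cdf ltr_pdivlMr ?ltr0n// [t * _]mulrC -truncn_lt_nat ?mulr_ge0//.
rewrite /quantile; set s := sort _ l; set i := Num.truncn _.
have ls : perm_eq s l by rewrite /s perm_sort.
have il : (i < size s)%N.
  by rewrite (perm_size ls) truncn_lt_nat ?mulr_ge0// gtr_pMr// ltr0n.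
have ss : sorted leq (map (code j) s).
  rewrite sorted_map; apply: (@sub_sorted _ (relpre (code k) leq)).
    by move=> a b /=; exact: code_le.
  by apply: sort_sorted => a b /=; exact: leq_total.
rewrite -(permP ls) -(nth_map _ 0%N)//.
have -> : count (fun x => code j x < v)%N s =
    count (fun c => c < v)%N (map (code j) s) by rewrite count_map.
have im : (i < size (map (code j) s))%N by rewrite size_map.
apply/idP/idP; last by move=> /nth_count_lt; apply.
apply: contraTT; rewrite -!leqNgt => ci.
by have := @nth_count_ge _ _ v 0%N _ i ss; rewrite /= ci im => /(_ isT).
Qed.

(** For t different from all limits L j v, the comparison of t with the
    distribution functions stabilizes, so the codes of the quantiles are
    eventually constant. *)
Lemma quantile_cvg (y : nat -> seq M) (u : nat -> nat) (L : nat -> nat -> R)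
    t :
  compact [set: M] -> basis_seq U ->
  (forall k, y k != [::]) -> {homo u : i j / (i < j)%N} ->
  (forall j v, (fun k => code_cdf j v (y (u k))) @ \oo --> L j v) ->
  0 <= t < 1 -> (forall j v, L j v != t) ->
  exists p : M, (fun k => quantile (u k) (y (u k)) t) @ \oo --> p.
Proof.
move=> cM Ub y0 uh uL t01 Lt; apply: (code_cvg cM Ub) => j.
have lt_ev v : \forall k \near \oo,
    (code j (quantile (u k) (y (u k)) t) < v)%N = (t < L j v).
  near=> k; rewrite code_quantile_lt//; last first.
    by near: k; exists j => // k /= jk; apply: leq_trans jk (homo_ltn_ge uh k).
  near: k; have [tL|tL] := ltP t (L j v).
    by apply: filterS (cvgr_gt _ (uL j v) _ tL) => k ->.
  have {}tL : L j v < t by rewrite lt_neqAle Lt.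
  apply: filterS (cvgr_lt _ (uL j v) _ tL) => k kt.
  by apply/negbTE; rewrite -leNgt ltW.
(* the constant value is the predecessor of the least v with t < L j v *)
have [|v tv vmin] := @ex_minnP (fun v => t < L j v).
  exists (2 ^ j)%N; have [k <-] := filter_ex (lt_ev (2 ^ j)%N).
  exact: code_lt.
case: v tv vmin => [tv _|v tv vmin].
  by have [k] := filter_ex (lt_ev 0%N); rewrite tv ltn0.
exists v; near=> k; apply/eqP.
rewrite eqn_leq -ltnS (near (lt_ev v.+1) k)// tv /=.
rewrite leqNgt (near (lt_ev v) k)//; apply/negP => /vmin.
by rewrite ltnn.
Unshelve. all: by end_near. Qed.

End quantile.

(** * Weak convergence of Borel probability measures *)

Section weak_convergence.
Variables (R : realType) (M : ptopologicalType).
Implicit Type mu : borel_prob R M.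

Lemma cvg_borel_probP (T : Type) (F : set_system T) (FF : Filter F)
    (e : T -> borel_prob R M) mu :
  (forall phi : continuousType M R,
    (fun t => weak_eval (e t) phi) @ F --> weak_eval mu phi) -> e @ F --> mu.
Proof.
move=> ephi.
have cvE : (fun t => weak_eval (e t)) @ F --> weak_eval mu.
  apply/cvg_sup => phi U.
  have /= -> :=
    @nbhsE (initial_topology (@proj _ (fun=> R) phi)) (weak_eval mu).
  case=> B [[C oC <-] Cphi] BU.
  have /ephi : nbhs (weak_eval mu phi) C by exact: open_nbhs_nbhs.
  by apply: (@filterS _ F FF) => t Ct; exact: BU.
move=> A; rewrite nbhsE => -[B [[C oC <-] Bmu] BA].
have /cvE : nbhs (weak_eval mu) C by apply: open_nbhs_nbhs.
by apply: (@filterS _ F FF) => t Ct; exact: BA.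
Qed.

Lemma weak_eval_cvg (T : Type) (F : set_system T) (FF : Filter F)
    (e : T -> borel_prob R M) mu (phi : continuousType M R) :
  e @ F --> mu -> (fun t => weak_eval (e t) phi) @ F --> weak_eval mu phi.
Proof.
move=> emu.
have wc : continuous (@weak_eval R M) by exact: initial_continuous.
have cvE : (fun t => weak_eval (e t)) @ F --> weak_eval mu.
  exact: (cvg_comp _ _ emu (wc mu)).
exact: (cvg_comp _ _ cvE (@proj_continuous _ (fun=> R) phi (weak_eval mu))).
Qed.

Lemma continuous_borel_measurable (phi : M -> R) : continuous phi ->
  measurable_fun [set: borel M] phi.
Proof.
move=> cphi; apply: (measurability _ (RGenOpens.measurableE R)).
move=> _ [_ [a [b ->] <-]]; rewrite setTI; apply: sub_sigma_algebra.
by move/continuousP : cphi; apply; exact: interval_open.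
Qed.

Lemma continuous_compact_bounded (phi : M -> R) :
  compact [set: M] -> continuous phi -> exists c, forall x, `|phi x| <= c.
Proof.
move=> cM cphi.
have /compact_bounded[c [_ cP]] : compact (phi @` setT).
  by apply: continuous_compact => //; exact: continuous_subspaceT.
by exists (c + 1) => x; apply: (cP (c + 1)); [rewrite ltrDl|exists x].
Qed.

Lemma weak_eval_borel_prob_of (P : probability (borel M) R)
    (phi : continuousType M R) :
  weak_eval (borel_prob_of P) phi = \int[P]_x phi x.
Proof.
rewrite /weak_eval /Rintegral; congr fine.
apply: eq_measure_integral => A mA _.
by rewrite /= /mtrunc; case: pselect.
Qed.

End weak_convergence.

(** * Empirical measures as laws of step functions on the unit interval *)

Section unit_prob.
Variable R : realType.

Definition unit_prob : set (measurableTypeR R) -> \bar R :=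
  mrestr (@lebesgue_measure R) (measurable_itv `[0 : R, 1[).

HB.instance Definition _ := Measure.on unit_prob.

Let unit_prob_setT : unit_prob setT = 1%E.
Proof.
by rewrite /unit_prob /mrestr setTI
  lebesgue_measure_itv /= lte_fin ltr01 -EFinD subr0.
Qed.

HB.instance Definition _ :=
  Measure_isProbability.Build _ _ _ unit_prob unit_prob_setT.

End unit_prob.

Section step.
Variables (R : realType).

Definition cell (N i : nat) : set R := `[i%:R / N%:R, i.+1%:R / N%:R[%classic.

Lemma cellE N i t : (0 < N)%N ->
  cell N i t <-> 0 <= t /\ Num.truncn (N%:R * t) = i.
Proof.
move=> N0; have N0' : 0 < N%:R :> R by rewrite ltr0n.
rewrite /cell /= in_itv /= ler_pdivrMr// ltr_pdivlMr// [t * _]mulrC; split.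
  move=> iN; split; last exact: truncn_def.
  case/andP: iN => + _; rewrite -(pmulr_rge0 t N0').
  by apply: le_trans; rewrite ler0n.
by move=> [t0 <-]; apply: truncn_itv; rewrite mulr_ge0// ltW.
Qed.

Lemma bigcup_cell N : (0 < N)%N ->
  \big[setU/set0]_(i <- iota 0 N) cell N i = `[0, 1[%classic.
Proof.
move=> N0; have N0' : 0 < N%:R :> R by rewrite ltr0n.
rewrite -bigcup_seq; apply/seteqP; split => t /=.
  move=> [i /=]; rewrite mem_iota => /andP[_ iN] /(cellE _ _ N0)[t0 ti].
  have Nt0 : 0 <= N%:R * t by rewrite mulr_ge0// ltW.
  by rewrite in_itv /= t0 /= -(gtr_pMr _ N0') -truncn_lt_nat// ti.
rewrite in_itv /= => /andP[t0 t1].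
exists (Num.truncn (N%:R * t)); last exact/cellE.
by rewrite /= mem_iota /= add0n truncn_lt_nat ?mulr_ge0// ?ltW// gtr_pMr.
Qed.

Lemma unit_prob_cell N i : (i < N)%N -> unit_prob (cell N i) = (N%:R^-1)%:E.
Proof.
move=> iN; have N0 : (0 < N)%N by apply: leq_trans iN.
have N0' : 0 < N%:R :> R by rewrite ltr0n.
rewrite /unit_prob /mrestr setIidl; last first.
  rewrite -(bigcup_cell N0) -bigcup_seq.
  by apply: bigcup_sup; rewrite /= mem_iota.
rewrite lebesgue_measure_itv /= lte_fin ltr_pM2r ?invr_gt0// ltr_nat ltnSn.
by rewrite -EFinD -mulrBl -natrB// subSnn mul1r.
Qed.

Lemma trivIset_cell N : (0 < N)%N -> trivIset setT (cell N).
Proof.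
move=> N0; move=> i j _ _ [t [/(cellE _ _ N0)[_ <-] /(cellE _ _ N0)[_ <-]]].
by [].
Qed.

Variables (M : ptopologicalType) (U : nat -> set M).

Lemma quantile_cell k l i t : l != [::] -> cell (size l) i t ->
  quantile U k l t = nth point (sort (relpre (code U k) leq) l) i.
Proof.
by move=> l0 /cellE[|_ ti]; [case: l l0|rewrite /quantile ti].
Qed.

(** The quantile function is a step function, so that even preimages of arbitrary
    sets are measurable. *)
Lemma quantile_preimage k l (B : set M) : l != [::] ->
  measurable (`[0 : R, 1[%classic `&` quantile U k l @^-1` B
    : set (measurableTypeR R)).
Proof.
move=> l0; have sl0 : (0 < size l)%N by case: l l0.
rewrite -(bigcup_cell sl0) -bigcup_seq setI_bigcupl.
rewrite [X in measurable X](_ : _ = \bigcup_(i in [set` iota 0 (size l)])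
    (if `[< B (nth point (sort (relpre (code U k) leq) l) i) >]
     then cell (size l) i else set0)).
  apply: fin_bigcup_measurable => [|i _]; first exact: finite_seq.
  by case: ifP => _; [exact: measurable_itv|exact: measurable0].
apply: eq_bigcupr => i _; apply/seteqP; split=> t /=.
  by move=> [ti]; rewrite (quantile_cell _ l0 ti) => /asboolP ->.
by case: asboolP => // Bi ti; split=> //; rewrite (quantile_cell _ l0 ti).
Qed.

Lemma integral_quantile k (l : seq M) (phi : M -> R) : l != [::] ->
  (\int[@unit_prob R]_(t in `[0%R, 1%R[) (phi (quantile U k l t))%:E)%E =
  ((\sum_(x <- l) phi x) / (size l)%:R)%:E.
Proof.
move=> l0; have sl0 : (0 < size l)%N by case: l l0.
rewrite -(bigcup_cell sl0) (@integral_bigsetU_EFin _ _ R (@unit_prob R))//=.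
- have ls : perm_eq l (sort (relpre (code U k) leq) l).
    by rewrite perm_sym perm_sort.
  rewrite [in RHS](perm_big _ ls) [in RHS](big_nth point) size_sort.
  rewrite mulr_suml -sumEFin /index_iota subn0 big_seq [RHS]big_seq.
  apply: eq_bigr => i; rewrite mem_iota /= add0n => il.
  rewrite (eq_integral
    (cst (phi (nth point (sort (relpre (code U k) leq) l) i))%:E)).
    rewrite integral_cst; last exact: measurable_itv.
    by rewrite EFinM; congr (_ * _)%E; exact: unit_prob_cell.
  by move=> t /set_mem ti; rewrite (quantile_cell _ l0 ti).
- by move=> i; exact: measurable_itv.
- exact: iota_uniq.
- exact: sub_trivIset (trivIset_cell sl0).
rewrite (bigcup_cell sl0); apply/measurable_EFinP => _ B mB.
exact: (@quantile_preimage k l (phi @^-1` B)).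
Qed.

End step.

(** * Sequential compactness of uniform distributions on finite lists *)

(** The limit measure is the law of the pointwise limit Z of the quantile
    functions along a subsequence on which all their distribution functions
    converge. *)
Lemma list_average_subcvg (R : realType) (M : ptopologicalType)
    (y : nat -> seq M) :
  hausdorff_space M -> @second_countable M -> compact [set: M] ->
  (forall k, y k != [::]) ->
  exists2 u : nat -> nat, {homo u : i j / (i < j)%N} &
  exists mu : borel_prob R M, forall phi : continuousType M R,
    (fun k => (\sum_(x <- y (u k)) phi x) / (size (y (u k)))%:R) @ \oo -->
    weak_eval mu phi.
Proof.
move=> hM scM cM y0; have [U Ub] := second_countable_seq scM.
have Ucl := compact_regular_basis hM cM Ub.
pose a k i :=
  if unpickle i is Some jv then code_cdf R U jv.1 jv.2 (y k) else 0.
have [|u uh [L0 aL0]] := diagonal_subseq (a := a).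
  move=> k i; rewrite /a; case: unpickle => [jv|]; first exact: code_cdf01.
  by rewrite lexx ler01.
exists u => //.
pose L (j v : nat) := L0 (pickle (j, v)).
have fL j v : (fun k => code_cdf R U j v (y (u k))) @ \oo --> L j v.
  by have := aL0 (pickle (j, v)); rewrite /a pickleK.
pose D : set (measurableTypeR R) := `[0, 1[%classic.
(* the countably many t at which the quantiles may fail to converge *)
pose N : set (measurableTypeR R) := [set t | exists j v, L j v = t].
have cN : countable N.
  apply: (@sub_countable _ _ N (range L0)).
    by apply: subset_card_le => t [j [v <-]]; exists (pickle (j, v)).
  exact: (sub_countable (card_image_le _ _) (countableP _)).
have mN : measurable N by exact: countable_measurable.
have mD : measurable D by exact: measurable_itv.
pose G := D `\` N.
have mG : measurable G by exact: measurableD.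
pose Zk k (t : measurableTypeR R) : M := quantile U (u k) (y (u k)) t.
have Zcvg t : G t -> exists p : M, Zk ^~ t @ \oo --> p.
  move=> Gt; case: (Gt) => Dt Nt.
  apply: (quantile_cvg cM Ub y0 uh fL) => [|j v].
    by move: Dt; rewrite /D /= in_itv.
  by apply/eqP => Lt; apply: Nt; exists j, v.
pose Z (t : measurableTypeR R) : borel M :=
  if t \in G then xget point [set p : M | Zk ^~ t @ \oo --> p] else point.
have ZkZ t : G t -> Zk ^~ t @ \oo --> (Z t : M).
  move=> Gt; rewrite /Z mem_set//; case: xgetP => // nZ.
  by have [p /nZ] := Zcvg t Gt.
have mZ : measurable_fun setT Z.
  rewrite -(setUv G); apply/measurable_funU => //; first exact: measurableC.
  split; last first.
    apply: (eq_measurable_fun (cst (point : borel M))) => // t /set_mem nGt.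
    by rewrite /Z memNset.
  apply: (measurability _ (erefl _ : @measurable _ (borel M) = <<s @open M>>)).
  move=> _ [B oB <-].
  (* by regularity, the limit lies in the open set B exactly when the sequence
     eventually stays in some basis set whose closure is inside B *)
  rewrite (_ : G `&` _ = G `&` \bigcup_(i in [set i | closure (U i) `<=` B])
      \bigcup_n \bigcap_(k in [set k | (n <= k)%N]) (D `&` Zk k @^-1` U i)).
    apply: measurableI => //; apply: bigcup_measurable => i _.
    apply: bigcupT_measurable => n; apply: bigcap_measurableType => k _.
    exact: quantile_preimage.
  apply/seteqP; split => t [Gt].
    move=> Bt; split=> //; have [|i Uit UiB] := Ucl (Z t) B.
      exact: open_nbhs_nbhs.
    exists i => //; have [|n _ nU] := ZkZ t Gt (U i).
      by apply: open_nbhs_nbhs; split=> //; exact: Ub.1.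
    by exists n => // k /= nk; split; [case: Gt|exact: nU].
  move=> [i /= UiB [n _ nU]]; split=> //; apply: UiB.
  have clU : closed (closure (U i)) by exact: closed_closure.
  apply: (closed_cvg _ clU _ (Z t : M) (ZkZ t Gt)).
  by exists n => // k nk; apply: subset_closure; have [] := nU k nk.
pose Zm : {mfun measurableTypeR R >-> borel M} :=
  HB.pack Z (isMeasurableFun.Build _ _ _ _ Z mZ).
exists (borel_prob_of (distribution (@unit_prob R) Zm)) => phi.
have cphi : continuous phi := @cts_fun _ _ phi.
have [c phic] := continuous_compact_bounded cM cphi.
have mphi := continuous_borel_measurable cphi.
have mphiZ : measurable_fun setT (EFin \o (phi \o Z)).
  by apply/measurable_EFinP; exact: measurableT_comp.
have iphiZ : (@unit_prob R).-integrable setT (EFin \o (phi \o Z)).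
  apply: measurable_bounded_integrable => //.
  - by rewrite [X in (X < _)%E](@probability_setT _ _ _ (@unit_prob R)) ltry.
  - exact/measurable_EFinP.
  exists c; split; first exact: num_real.
  by move=> c' cc' t _; exact: le_trans (phic _) (ltW cc').
rewrite weak_eval_borel_prob_of /Rintegral integral_distribution//=; last first.
  exact/measurable_EFinP.
rewrite (negligible_integral (N := ~` D))//=; last first.
- by rewrite /unit_prob /mrestr /= setICl measure0.
- exact: measurableC.
rewrite setTD setCK.
have [] := @dominated_convergence _ _ R (@unit_prob R) D mD
  (fun k => EFin \o (phi \o Zk k)) (EFin \o (phi \o Z)) (cst c%:E).
- move=> k; apply/measurable_EFinP => _ B mB.
  exact: (quantile_preimage _ _ (phi @^-1` B) (y0 _)).
- exact: measurable_funTS.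
- exists N; split => //.
    apply: (subset_measure0 _ _ _ (countable_lebesgue_measure0 cN)) => //.
    exact: measurableI.
  move=> t /= /not_implyP[Dt nt]; apply: contrapT => Nt; apply: nt.
  apply: cvg_EFin; first by near=> k.
  exact: (cvg_comp _ _ (ZkZ t (conj Dt Nt)) (cphi _)).
- exact: finite_measure_integrable_cst.
- by apply/aeW => t k _; rewrite /= lee_fin.
move=> iD _ /=.
under eq_fun do rewrite integral_quantile//.
rewrite -[X in _ --> X -> _]fineK; first by move=> /fine_cvgP[_].
exact: integrable_fin_num.
Unshelve. all: by end_near. Qed.

(** * Empirical measures of an orbit *)

Section empirical.
Variables (R : realType) (M : ptopologicalType) (f : M -> M).

Lemma ge0_integral_empirical x n (g : borel M -> \bar R) :
  measurable_fun setT g -> (forall y, 0 <= g y)%E ->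
  (\int[empirical_measure R f x n]_y g y =
   (n.+1%:R^-1)%:E * \sum_(j < n.+1) g (iter j f x))%E.
Proof.
move=> mg g0; rewrite ge0_integral_mscale//; congr (_ * _)%E.
rewrite ge0_integral_measure_sum//; apply: eq_bigr => j _.
by rewrite integral_dirac// diracT mul1e.
Qed.

Lemma weak_eval_empirical x n (phi : continuousType M R) :
  weak_eval (empirical R f x n) phi =
  (\sum_(j < n.+1) phi (iter j f x)) / n.+1%:R.
Proof.
have cphi : continuous phi := @cts_fun _ _ phi.
have mphi : measurable_fun [set: borel M] (EFin \o phi).
  by apply/measurable_EFinP; exact: continuous_borel_measurable.
rewrite weak_eval_borel_prob_of /Rintegral integralE.
rewrite !ge0_integral_empirical//; last 2 first.
- exact: measurable_funeneg.
- exact: measurable_funepos.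
rewrite (eq_bigr
    (fun j : 'I_n.+1 => (Num.max (phi (iter j f x)) 0)%:E)); last first.
  by move=> j _; rewrite funeposE /= EFin_max.
rewrite [X in (_ - _ * X)%E](eq_bigr
    (fun j : 'I_n.+1 => (Num.max (- phi (iter j f x)) 0)%:E)); last first.
  by move=> j _; rewrite funenegE /= EFin_max.
rewrite !sumEFin -!EFinM -EFinB /= -mulrBr mulrC -sumrB; congr (_ / _).
by apply: eq_bigr => j _; rewrite !maxEle; case: ifP; case: ifP; lra.
Qed.

Hypotheses (hM : hausdorff_space M) (scM : @second_countable M).
Hypotheses (cM : compact [set: M]) (cf : continuous f).

Lemma continuous_iter j : continuous (iter j f).
Proof.
elim: j => [|j IH] x; first exact: cvg_id.
exact: (continuous_comp (IH x) (@cf _)).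
Qed.

Lemma continuous_empirical n : continuous (fun x => empirical R f x n).
Proof.
move=> x; apply: cvg_borel_probP => phi.
rewrite weak_eval_empirical; under eq_fun do rewrite weak_eval_empirical.
apply: cvgMl; apply: cvg_big => [|j _]; first exact: add_continuous.
exact: (continuous_comp (@continuous_iter j x) (@cts_fun _ _ phi _)).
Qed.

Lemma empirical_subcvg x (s : nat -> nat) :
  exists2 u : nat -> nat, {homo u : i j / (i < j)%N} &
  exists mu : borel_prob R M,
    (fun k => empirical R f x (s (u k))) @ \oo --> mu.
Proof.
have [//|u uh [mu mucvg]] := @list_average_subcvg R M
  (fun k => [seq iter j f x | j <- iota 0 (s k).+1]) hM scM cM.
exists u => //; exists mu; apply: cvg_borel_probP => phi.
apply: cvg_trans (mucvg phi); apply: near_eq_cvg; apply: nearW => k.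
rewrite weak_eval_empirical size_map size_iota big_map.
by rewrite -[iota _ _]/(index_iota 0 (s (u k)).+1) big_mkord.
Qed.

(** Adding one point changes the average a of phi by (phi - a) / (n + 2), which
    tends to 0 as phi is bounded. *)
Lemma empirical_shift x (s : nat -> nat) (mu : borel_prob R M) :
  {homo s : i j / (i < j)%N} ->
  (fun k => empirical R f x (s k)) @ \oo --> mu ->
  (fun k => empirical R f x (s k).+1) @ \oo --> mu.
Proof.
move=> sh smu; apply: cvg_borel_probP => phi.
have [c phic] := continuous_compact_bounded cM (@cts_fun _ _ phi).
pose v n : R := phi (iter n f x).
pose a n : R := weak_eval (empirical R f x n) phi.
have aS n : a n.+1 = a n + (v n.+1 - a n) / n.+2%:R.
  rewrite /a !weak_eval_empirical big_ord_recr /= -[phi (f _)]/(v n.+1).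
  set S := \sum_(_ < _) _; have n0 : n%:R >= 0 :> R by rewrite ler0n.
  move: S (v n.+1) => S w.
  rewrite -[n.+2]addn2 -[in X in _ = X](addn1 n) !natrD; field.
  by apply/andP; split; lra.
have ac n : `|a n| <= c.
  rewrite /a weak_eval_empirical normrM normfV normr_nat ler_pdivrMr ?ltr0n//.
  apply: le_trans (ler_norm_sum _ _ _) _.
  apply: le_trans (ler_sum _ (fun j _ => phic _)) _.
  by rewrite sumr_const card_ord mulr_natr.
have c0 : 0 <= c by apply: le_trans (phic x).
suff : (fun k => a (s k).+1) @ \oo --> weak_eval mu phi by [].
under eq_fun do rewrite aS.
rewrite -[weak_eval mu phi]addr0; apply: cvgD; first exact: weak_eval_cvg.
apply/cvgr0Pnorm_lt => e e0; near=> k.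
rewrite normrM normfV normr_nat ltr_pdivrMr ?ltr0n//.
apply: (@le_lt_trans _ _ (c + c)).
  by apply: le_trans (ler_normB _ _) _; apply: lerD; [exact: phic|exact: ac].
rewrite mulrC -ltr_pdivrMr//.
have : (Num.truncn ((c + c) / e) <= k)%N.
  by near: k; exists (Num.truncn ((c + c) / e)).
move=> tk; apply: lt_le_trans (truncnS_gt _) _.
by rewrite ler_nat ltnS (leq_trans tk)// (leq_trans (homo_ltn_ge sh k)).
Unshelve. all: by end_near. Qed.

End empirical.

(** * Topology given by a metric *)

Section metric.
Variables (R : realType) (P : topologicalType) (dist : P -> P -> R).
Hypothesis distP : metrizes dist.

Lemma metrizes_ge0 x y : 0 <= dist x y.
Proof.
have [d0 dC dT _] := distP; have := dT x y x.
by rewrite (d0 x x).2// (dC y x); lra.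
Qed.

Lemma metrizes_cvgP (T : Type) (F : set_system T) (FF : Filter F)
    (e : T -> P) p :
  e @ F --> p <-> forall eps, 0 < eps -> \forall t \near F, dist (e t) p < eps.
Proof.
have [d0 dC dT dn] := distP; split=> [ep eps eps0|ep A].
  have : nbhs p [set q | dist p q < eps] by rewrite dn; exists eps.
  by move=> /ep; apply: (@filterS _ F FF) => t /=; rewrite dC.
rewrite dn => -[eps /= eps0 pA]; apply: (@filterS _ F FF) (ep _ eps0) => t.
by rewrite dC => /pA.
Qed.

Lemma metrizes_ball_open p eps : open [set q | dist q p < eps].
Proof.
have [d0 dC dT dn] := distP; rewrite openE => q /= qp.
rewrite /interior dn; exists (eps - dist q p) => /=; first by rewrite subr_gt0.
by move=> r /= qr; have := dT r q p; rewrite (dC r q); lra.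
Qed.

Lemma dist_set_lt (A : set P) p eps :
  (dist_set dist A p < eps%:E)%E <-> exists2 q, A q & dist q p < eps.
Proof.
split=> [/ereal_inf_lt[_ [q Aq <-]]|[q Aq qp]].
  by rewrite lte_fin; exists q.
apply: (@le_lt_trans _ _ (dist q p)%:E); last by rewrite lte_fin.
by apply: ereal_inf_lbound; exists q.
Qed.

Lemma metrizes_cvg_unique (T : Type) (F : set_system T) (FF : ProperFilter F)
    (e : T -> P) (p q : P) : e @ F --> p -> e @ F --> q -> p = q.
Proof.
have [d0 dC dT dn] := distP.
move=> /metrizes_cvgP ep /metrizes_cvgP eq; apply/d0/eqP.
rewrite eq_le metrizes_ge0 andbT.
apply/ler_addgt0Pl => eps eps0; rewrite addr0.
have e2 : 0 < eps / 2 by rewrite divr_gt0.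
have [t [tp tq]] := filter_ex (filterI (ep _ e2) (eq _ e2)).
by have := dT p (e t) q; rewrite (dC p (e t)); move: tp tq => /=; lra.
Qed.

Lemma finite_set_isolated (A : set P) p : finite_set A ->
  exists2 eps, 0 < eps & forall q, A q -> dist q p < eps -> q = p.
Proof.
have [d0 _ _ _] := distP; move=> /finite_seqP[s ->].
elim: s => [|a s [eps eps0 IH]].
  by exists 1.
have [ap|ap] := pselect (a = p).
  by exists eps => // q /=; rewrite inE => /predU1P[->|/IH].
have ap0 : 0 < dist a p.
  by rewrite lt_neqAle metrizes_ge0 andbT eq_sym; apply/eqP => /d0.
exists (Num.min eps (dist a p)); first by rewrite lt_min eps0.
move=> q /=; rewrite inE lt_min => /predU1P[->|/IH + /andP[]].
  by rewrite ltxx andbF.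
by move=> + ? _; apply.
Qed.

End metric.

(** * Limit sets of empirical measures *)

Section limits.
Variables (R : realType) (M : ptopologicalType) (f : M -> M).
Hypotheses (hM : hausdorff_space M) (scM : @second_countable M).
Hypotheses (cM : compact [set: M]) (cf : continuous f).
Variable dist : borel_prob R M -> borel_prob R M -> R.
Hypothesis distP : metrizes dist.
Local Notation e := (empirical R f).

(* Distances and the numbers 1 / (n + 1) are generalized so that each becomes a
   single atom of the linear problem. *)
Ltac dist_lra := rewrite /=; repeat match goal with |- context [dist ?a ?b] =>
  let d := fresh in set d := dist a b; clearbody d end;
  repeat match goal with |- context [?n.+1%:R^-1] =>
  is_var n; let d := fresh in set d := n.+1%:R^-1; clearbody d end; lra.

Lemma pomega_subcvg x (s : nat -> nat) : {homo s : i j / (i < j)%N} ->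
  exists2 mu, pomega f x mu &
  exists2 u : nat -> nat, {homo u : i j / (i < j)%N} &
  (fun k => e x (s (u k))) @ \oo --> mu.
Proof.
move=> sh; have [u uh [mu smu]] := empirical_subcvg R f hM scM cM x s.
exists mu; last by exists u.
by exists (s \o u) => // i j ij; apply: sh; exact: uh.
Qed.

(** The margin 1 / (l + 1) keeps the strict inequality in the limit; conversely,
    infinitely many visits to a ball produce a limit by compactness. This
    replaces a quantification over limits by countable operations. *)
Lemma eps_basinP eps mu x : eps_basin f dist eps mu x <->
  exists l, forall N, exists2 n, (N <= n)%N &
    dist (e x n) mu < eps - l.+1%:R^-1.
Proof.
have [d0 dC dT _] := distP; rewrite /eps_basin /=; split.
  move=> /dist_set_lt[nu [s sh /(metrizes_cvgP distP) snu] numu].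
  have e0 : 0 < (eps - dist nu mu) / 2 by rewrite divr_gt0// subr_gt0.
  have [l _ /(_ l (leqnn l)) /= le] := near_infty_natSinv_lt (PosNum e0).
  exists l => N; have [N' _ sN'] := snu _ e0.
  exists (s (maxn N N')).
    by apply: leq_trans (leq_maxl _ N') (homo_ltn_ge sh _).
  have := sN' (maxn N N') (leq_maxr _ _).
  have := dT (e x (s (maxn N N'))) nu mu.
  by move: le; dist_lra.
move=> [l freq]; have [s sh sq] := frequently_subseq (fun=> freq).
have [nu xnu [u uh /(metrizes_cvgP distP) unu]] := pomega_subcvg x sh.
apply/dist_set_lt; exists nu => //.
have l0 : 0 < l.+1%:R^-1 :> R by rewrite invr_gt0.
have [k uk] := filter_ex (unu _ l0).
have := dT nu (e x (s (u k))) mu; have := sq (u k).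
by move: uk; rewrite (dC nu (e x _)); dist_lra.
Qed.

(** In a compact metric setting, a sequence with a single limit point
    converges. *)
Lemma basinP mu x : basin f mu x <-> e x @ \oo --> mu.
Proof.
rewrite /basin /=; split=> [xmu|xmu].
  apply/(metrizes_cvgP distP) => eps eps0; apply: contrapT => nev.
  have [_ N|s sh sfar] :=
      frequently_subseq (P := fun _ n => ~ (dist (e x n) mu < eps)).
    apply: contrapT => nN; apply: nev; exists N => // n Nn.
    apply: contrapT => nn.
    by apply: nN; exists n.
  have [nu] := pomega_subcvg x sh.
  rewrite xmu => -> [u uh /(metrizes_cvgP distP) unu].
  by have [k /sfar] := filter_ex (unu _ eps0).
apply/seteqP; split=> [nu [s sh snu]|_ ->]; last by exists id.
rewrite /=; apply: (metrizes_cvg_unique distP _ snu).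
exact: (cvg_comp _ _ (cvg_homo_ltn sh) xmu).
Qed.

Lemma measurable_empirical_ball n mu eps :
  measurable ([set x | dist (e x n) mu < eps] : set (borel M)).
Proof.
apply: sub_sigma_algebra.
have /continuousP ce := @continuous_empirical R M f cf n.
exact: (ce _ (metrizes_ball_open distP mu eps)).
Qed.

Lemma measurable_eps_basin eps mu :
  measurable (eps_basin f dist eps mu : set (borel M)).
Proof.
rewrite (_ : eps_basin _ _ _ _ =
    \bigcup_l \bigcap_N \bigcup_(n in [set n | (N <= n)%N])
    [set x | dist (e x n) mu < eps - l.+1%:R^-1]).
  apply: bigcupT_measurable => l; apply: bigcapT_measurable => N.
  by apply: bigcup_measurable => n _; exact: measurable_empirical_ball.
apply/seteqP; split=> x.
  by move=> /eps_basinP[l lN]; exists l => // N _; have [n] := lN N; exists n.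
move=> [l _ lN]; apply/eps_basinP; exists l => N.
by have [n] := lN N I; exists n.
Qed.

Lemma measurable_basin (mu : borel_prob R M) :
  measurable (basin f mu : set (borel M)).
Proof.
rewrite (_ : basin _ _ =
    \bigcap_l \bigcup_N \bigcap_(n in [set n | (N <= n)%N])
    [set x | dist (e x n) mu < l.+1%:R^-1]).
  apply: bigcapT_measurable => l; apply: bigcupT_measurable => N.
  by apply: bigcap_measurableType => n _; exact: measurable_empirical_ball.
apply/seteqP; split=> x.
  move=> /basinP/(metrizes_cvgP distP) xmu l _.
  by have [|N _ Nx] := xmu l.+1%:R^-1; [rewrite invr_gt0|exists N].
move=> xl; apply/basinP/(metrizes_cvgP distP) => eps eps0.
have [l _ /(_ l (leqnn l)) /= leps] := near_infty_natSinv_lt (PosNum eps0).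
have [N _ Nx] := xl l I; exists N => // n Nn.
by apply: lt_trans leps; exact: Nx.
Qed.

Lemma empirical_dense : exists d : nat -> M, forall x n eps, 0 < eps ->
  exists i, dist (e x n) (e (d i) n) < eps.
Proof.
have [d0 dC _ _] := distP.
have [U [_ Ub]] := second_countable_seq scM.
exists (fun i => xget point (U i)) => x n eps eps0.
have : nbhs x [set y | dist (e y n) (e x n) < eps].
  apply: (@continuous_empirical R M f cf n x [set q | dist q (e x n) < eps]).
  apply: open_nbhs_nbhs; split; first exact: metrizes_ball_open.
  by rewrite /= (d0 _ _).2.
move=> /Ub[i Uix Ui]; exists i; rewrite dC; apply: Ui.
by case: xgetP => // /(_ x).
Qed.

(** If a limit mu of the orbit of x is not observable, only a null set of points
    have a limit set meeting some ball around mu. That ball contains a smaller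
    ball with center e_n(d i) and radius 1 / (l + 1) to which mu belongs. There are countably many
    of the latter, so the exceptional x are covered by countably many null
    sets. *)
Lemma pomega_observable (m : probability (borel M) R) :
  m.-negligible [set x | ~ (pomega f x `<=` observable f m dist)].
Proof.
have [d0 dC dT _] := distP; have [d dP] := empirical_dense.
pose B i n l := eps_basin f dist l.+1%:R^-1 (e (d i) n) : set (borel M).
pose F q := if unpickle q is Some (i, n, l) then
  if m (B i n l) == 0%E then B i n l else set0 else set0.
apply: (@negligibleS _ _ _ _ (\bigcup_q F q)); last first.
  apply: negligible_bigcup => q; rewrite /F.
  case: unpickle => [[[i n] l]|]; last first.
    exact: negligible_set0.
  case: eqP => [B0|_]; last exact: negligible_set0.
  by apply/negligibleP => //; exact: measurable_eps_basin.
move=> x /= /existsNP[mu /not_implyP[xmu]].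
move=> /existsNP[eps /not_implyP[eps0 mueps]].
have e2 : 0 < eps / 2 by rewrite divr_gt0.
have [l _ /(_ l (leqnn l)) /= leps] := near_infty_natSinv_lt (PosNum e2).
have l0 : 0 < l.+1%:R^-1 / 2 :> R by rewrite divr_gt0// invr_gt0.
have [s sh /(metrizes_cvgP distP)/(_ _ l0)/filter_ex[k sk]] := xmu.
have [i id] := dP x (s k) _ l0.
have mud : dist mu (e (d i) (s k)) < l.+1%:R^-1.
  have := dT mu (e x (s k)) (e (d i) (s k)).
  by rewrite (dC mu (e x (s k))); move: sk id; dist_lra.
exists (pickle (i, s k, l)) => //; rewrite /F pickleK.
rewrite ifT; first by apply/dist_set_lt; exists mu.
rewrite eq_le measure_ge0 andbT; apply: contra_notT mueps.
rewrite -ltNge => /lt_le_trans; apply.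
apply: le_measure; rewrite ?inE; [exact: measurable_eps_basin..|].
move=> z /dist_set_lt[nu znu nud]; apply/dist_set_lt; exists nu => //.
have := dT nu (e (d i) (s k)) mu; rewrite (dC _ mu) /=.
by move: (dC (e (d i) (s k)) mu) mud nud leps; dist_lra.
Qed.

(** Two limits would make the orbit of measures leave a ball around the first one
    infinitely often. At the exit times the measures have a limit in the ball,
    which is the center by isolation; by [empirical_shift] the next terms have the
    same limit, but they are outside the ball. *)
Lemma finite_pomega_set1 x : finite_set (@pomega R M f x) ->
  exists mu, @pomega R M f x = [set mu].
Proof.
have [d0 dC dT _] := distP => fin.
have [mu xmu _] := pomega_subcvg x (s := id) (fun _ _ => id).
exists mu; apply/seteqP; split=> [nu xnu|_ ->//]; apply: contrapT => /eqP numu.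
have [eps eps0 epsP] : exists2 eps, 0 < eps &
    forall q, pomega f x q -> dist q mu < eps + eps -> q = mu.
  have [eps eps0 epsP] := finite_set_isolated distP mu fin.
  exists (eps / 2); first by rewrite divr_gt0.
  by move=> q xq; rewrite -splitr; exact: epsP.
have exits N : exists2 n, (N <= n)%N &
    dist (e x n) mu < eps /\ ~ dist (e x n.+1) mu < eps.
  have [s sh /(metrizes_cvgP distP)/(_ _ eps0)/=smu] := xmu.
  have [s' sh' /(metrizes_cvgP distP)/(_ _ eps0)/=snu] := xnu.
  have [k [ks Nk]] := filter_ex (filterI smu (nbhs_infty_ge N)).
  have [k' [ks' Nk']] := filter_ex (filterI snu (nbhs_infty_ge (s k))).
  apply: contrapT => stay.
  have stays j : dist (e x (s k + j)) mu < eps.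
    elim: j => [|j IH]; first by rewrite addn0.
    apply: contrapT => out; apply: stay.
    exists (s k + j)%N; last by rewrite -addnS.
    by rewrite (leq_trans Nk)// (leq_trans (homo_ltn_ge sh k))// leq_addr.
  have skk : (s k <= s' k')%N by exact: leq_trans Nk' (homo_ltn_ge sh' k').
  have := stays (s' k' - s k)%N; rewrite subnKC// => numu'.
  have nu_mu : nu = mu.
    apply: epsP => //; have := dT nu (e x (s' k')) mu.
    by rewrite (dC nu (e x (s' k'))); move: ks' numu'; dist_lra.
  by rewrite nu_mu eqxx in numu.
have [s sh sP] := frequently_subseq (fun=> exits).
have [q xq [u uh uq]] := pomega_subcvg x sh.
have qmu : q = mu.
  apply: epsP => //.
  have [k uk] := filter_ex ((metrizes_cvgP distP _ _ _).1 uq _ eps0).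
  have := dT q (e x (s (u k))) mu; rewrite (dC q (e x _)).
  by have [] := sP (u k); move: uk; dist_lra.
have := empirical_shift cM (s := s \o u) _ uq.
rewrite qmu => /(_ _)/(metrizes_cvgP distP)/(_ _ eps0)/filter_ex[|k].
  by move=> i j ij; apply: sh; exact: uh.
by have [_] := sP (u k).
Qed.

End limits.

(** * Observable and SRB measures *)

Section observable.
Variables (R : realType) (M : ptopologicalType) (f : M -> M).
Hypotheses (hM : hausdorff_space M) (scM : @second_countable M).
Hypotheses (cM : compact [set: M]) (cf : continuous f).
Variable dist : borel_prob R M -> borel_prob R M -> R.
Hypothesis distP : metrizes dist.
Variable m : probability (borel M) R.

Lemma SRB_observable : SRB f m `<=` observable f m dist.
Proof.
have [d0 _ _ _] := distP => mu mu_srb eps eps0; apply: lt_le_trans mu_srb _.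
apply: le_measure; rewrite ?inE.
- exact: (measurable_basin hM scM cM cf distP).
- exact: (measurable_eps_basin hM scM cM cf distP).
move=> x xmu; apply/dist_set_lt.
by exists mu; [rewrite xmu|rewrite (d0 _ _).2].
Qed.

(** A ball around a measure outside S that avoids the finite set S is met by no
    limit set of a point in the basins of S. *)
Lemma observable_sub_cover (S : set (borel_prob R M)) : finite_set S ->
  m.-negligible (~` \bigcup_(mu in S) basin f mu) ->
  observable f m dist `<=` S.
Proof.
move=> finS negS mu muO; apply: contrapT => muS.
have [eps eps0 epsP] := finite_set_isolated distP mu finS.
have : m.-negligible (eps_basin f dist eps mu).
  apply: negligibleS negS => x /dist_set_lt[nu xnu numu] [q Sq xq].
  by move: xnu; rewrite xq => nuq; apply: muS; rewrite -(epsP q)// -nuq.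
have mA := measurable_eps_basin hM scM cM cf distP eps mu.
by move=> /(negligibleP m mA) m0; have := muO _ eps0; rewrite m0 ltxx.
Qed.

(** Almost every point is in the basin of an observable measure, and the finitely
    many observable measures that are not SRB have null basins. *)
Lemma finite_observable_cover : finite_set (observable f m dist) ->
  m.-negligible (~` \bigcup_(mu in SRB f m) basin f mu).
Proof.
move=> finO.
have nO : m.-negligible
    (\bigcup_(mu in observable f m dist `\` SRB f m) basin f mu).
  have /finite_seqP[s sE] : finite_set (observable f m dist `\` SRB f m).
    exact: finite_setD.
  rewrite sE bigcup_seq big_seq; elim/big_ind: _ => [|B C|mu mus].
  - exact: negligible_set0.
  - exact: negligibleU.
  have [_ mu_nsrb] : (observable f m dist `\` SRB f m) mu by rewrite sE.
  apply/negligibleP; first exact: (measurable_basin hM scM cM cf distP).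
  by apply/eqP; rewrite eq_le measure_ge0 andbT leNgt; apply/negP.
have nP := pomega_observable hM scM cM cf distP m.
apply: negligibleS (negligibleU nP nO) => x xS.
have [xO|xO] := pselect (pomega f x `<=` observable f m dist); [right|by left].
have [mu xmu] := finite_pomega_set1 hM scM cM distP (sub_finite_set xO finO).
exists mu; last exact: xmu.
split; first by apply: xO; rewrite xmu.
by move=> mu_srb; apply: xS; exists mu.
Qed.

End observable.

Theorem theorem1p6 (R : realType) (n : nat) (M : ptopologicalType)
    (hausdorffM : hausdorff_space M) (countableM : @second_countable M)
    (compactM : compact [set: M]) (A : C1_atlas R n M)
    (m : probability (borel M) R) (lebesgue_m : is_lebesgue A m)
    (dist : borel_prob R M -> borel_prob R M -> R)
    (metrizes_dist : metrizes dist)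
    (f : M -> M) (continuous_f : continuous f) :
  (finite_set (observable f m dist) <->
   exists S : set (borel_prob R M),
     [/\ finite_set S, S `<=` SRB f m &
         m.-negligible (~` \bigcup_(mu in S) basin f mu)]) /\
  (finite_set (observable f m dist) -> observable f m dist = SRB f m).
Proof.
have srbO : SRB f m `<=` observable f m dist.
  exact: (SRB_observable hausdorffM countableM compactM continuous_f
    metrizes_dist).
have finO_cover : finite_set (observable f m dist) ->
    finite_set (SRB f m) /\
    m.-negligible (~` \bigcup_(mu in SRB f m) basin f mu).
  move=> finO; split; first exact: sub_finite_set finO.
  exact: (finite_observable_cover hausdorffM countableM compactM continuous_f
    metrizes_dist).
split; last first.
  move=> /finO_cover[finS negS]; apply/seteqP; split=> //.
  exact: (observable_sub_cover hausdorffM countableM compactM continuous_f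
    metrizes_dist finS negS).
split=> [/finO_cover[finS negS]|[S [finS _ negS]]].
  by exists (SRB f m); split.
apply: (sub_finite_set _ finS).
exact: (observable_sub_cover hausdorffM countableM compactM continuous_f
  metrizes_dist finS negS).
Qed.
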